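(* Let $A_1,\dots,A_m$ be real symmetric positive semidefinite $n\times n$ matrices, let $c_1,\dots,c_m\in\mathbb{R}^n$ and $b=(b_1,\dots,b_m)^T\in\mathbb{R}^m$. For $z=(x,s)\in\mathbb{R}^{n+m}$ with $x\in\mathbb{R}^n$ and $s=(s_1,\dots,s_m)\in\mathbb{R}^m$, let $q_k(z)=x^TA_kx+c_k^Tx+s_k^2$ for $k=1,\dots,m$, and $Q(z)=(q_1(z),\dots,q_m(z))^T$. Then the system $Q(z)=b$ has a solution $z\in\mathbb{R}^{n+m}$ if and only if $b$ lies in $conv(\{Q(z):z\in\mathbb{R}^{n+m}\})$.
   Context: $conv(T)$ denotes the convex hull of a set $T\subset\mathbb{R}^m$. *)

(* Defs.v *)
From mathcomp Require Import all_boot all_order all_algebra.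
From mathcomp Require Import classical_sets reals convex.

Set Implicit Arguments.
Unset Strict Implicit.
Unset Printing Implicit Defensive.
Import Order.TTheory GRing.Theory Num.Theory.
Local Open Scope classical_set_scope.
Local Open Scope ring_scope.

Definition psdmx (R : realType) (n : nat) (A : 'M[R]_n) : Prop :=
  A \is symmetricmx /\ forall x : 'cV[R]_n, 0 <= (x^T *m A *m x) 0 0.

Definition convex_hull (R : realType) (E : lmodType R) (T : set E) : set E :=
  smallest (@convex_set R E) T.

(* A point z = (x, s) of R^(n+m) is a column vector whose upper block is
   x = usubmx z and whose lower block is s = dsubmx z. *)
Definition quad (R : realType) (n m : nat) (A : 'I_m -> 'M[R]_n)
    (c : 'I_m -> 'cV[R]_n) (k : 'I_m) (z : 'cV[R]_(n + m)) : R :=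
  let x := usubmx z in let s := dsubmx z in
  (x^T *m A k *m x) 0 0 + ((c k)^T *m x) 0 0 + s k 0 ^+ 2.

Definition quad_map (R : realType) (n m : nat) (A : 'I_m -> 'M[R]_n)
    (c : 'I_m -> 'cV[R]_n) (z : 'cV[R]_(n + m)) : 'cV[R]_m :=
  \col_(k < m) quad A c k z.

(* Main.v *)
Require Import Defs.
From mathcomp Require Import all_boot all_order all_algebra.
From mathcomp Require Import classical_sets reals.
From mathcomp Require Import interval_inference convex ring.

(** The range of [Q] is itself convex. Since [s_k ^ 2] is an arbitrary
    nonnegative number, the range is the epigraph-like set of the [y] for which
    some [x] satisfies [f_k x <= y_k] for all [k], where
    [f_k x = x^T A_k x + c_k^T x]; each [f_k] is convex because
    [t f_k x + (1-t) f_k y - f_k (t x + (1-t) y) = t (1-t) (x-y)^T A_k (x-y)]. *)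

Set Implicit Arguments.
Unset Strict Implicit.
Unset Printing Implicit Defensive.
Import Order.TTheory GRing.Theory Num.Theory.
Local Open Scope classical_set_scope.
Local Open Scope ring_scope.

Definition qform (R : realType) (n : nat) (A : 'M[R]_n) (c x : 'cV[R]_n) : R :=
  (x^T *m A *m x) 0 0 + (c^T *m x) 0 0.

Lemma qform_conv (R : realType) (n : nat) (A : 'M[R]_n) (c x y : 'cV[R]_n)
    (t : R) :
  qform A c (t *: x + (1 - t) *: y) =
  t * qform A c x + (1 - t) * qform A c y
    - t * (1 - t) * ((x - y)^T *m A *m (x - y)) 0 0.
Proof.
rewrite /qform !linearD !linearN /= !linearZ /=.
rewrite !(mulmxDl, mulmxDr, mulNmx, mulmxN) -!(scalemxAl, scalemxAr).
(* [ring] treats the cross terms x^T A y and y^T A x as separate atoms; each has coefficient t (1-t)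
   on both sides. *)
rewrite !mxE; ring.
Qed.

Lemma qform_convex (R : realType) (n : nat) (A : 'M[R]_n) (c x y : 'cV[R]_n)
    (t : R) :
  psdmx A -> 0 <= t <= 1 ->
  qform A c (t *: x + (1 - t) *: y) <= t * qform A c x + (1 - t) * qform A c y.
Proof.
move=> [_ A_ge0] /andP[t_ge0 t_le1].
by rewrite qform_conv gerBl !mulr_ge0 ?subr_ge0.
Qed.

Lemma range_quad_mapP (R : realType) (n m : nat) (A : 'I_m -> 'M[R]_n)
    (c : 'I_m -> 'cV[R]_n) (b : 'cV[R]_m) :
  range (quad_map A c) b <->
  exists x : 'cV[R]_n, forall k, qform (A k) (c k) x <= b k 0.
Proof.
split=> [[z _ <-]|[x x_le]].
  by exists (usubmx z) => k; rewrite mxE lerDl sqr_ge0.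
(* Each s_k is the root of the slack b_k - f_k x, so s_k^2 fills the gap exactly; by [x_le] the
   slack is nonnegative, hence [Num.sqrt] does not fall back to 0. *)
exists (col_mx x (\col_k Num.sqrt (b k 0 - qform (A k) (c k) x))) => //.
apply/colP => k; rewrite mxE /quad /= col_mxKu col_mxKd [in X in _ + X]mxE.
rewrite sqr_sqrtr ?subr_ge0//.
by rewrite addrC subrK.
Qed.

Lemma convex_range_quad_map (R : realType) (n m : nat) (A : 'I_m -> 'M[R]_n)
    (c : 'I_m -> 'cV[R]_n) :
  (forall k, psdmx (A k)) -> convex_set (range (quad_map A c)).
Proof.
move=> hA y1 y2 t; rewrite !inE.
move=> /range_quad_mapP[x1 x1_le] /range_quad_mapP[x2 x2_le].
have t01 : 0 <= t%:num <= 1 by rewrite ge0 le1.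
(* One and the same combination of [x1] and [x2] must serve all k at once; it does, since the
   weights do not depend on k. *)
apply/range_quad_mapP; exists (t%:num *: x1 + (1 - t%:num) *: x2) => k.
apply: le_trans (qform_convex _ _ _ (hA k) t01) _.
have /andP[t_ge0 t_le1] := t01.
by rewrite !mxE lerD// ler_wpM2l// subr_ge0.
Qed.

Theorem theorem5 (R : realType) (n m : nat) (A : 'I_m -> 'M[R]_n)
    (c : 'I_m -> 'cV[R]_n) (b : 'cV[R]_m)
    (hA : forall k : 'I_m, psdmx (A k)) :
  (exists z : 'cV[R]_(n + m), quad_map A c z = b) <->
  convex_hull (range (quad_map A c)) b.
Proof.
(* The range, being convex, is its own hull. *)
rewrite /convex_hull smallest_id; last exact: convex_range_quad_map.
by split=> [[z <-]|[z _ <-]]; [exists z | exists z].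
Qed.
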